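(* Let $\kappa$ be an uncountable regular cardinal such that every $\kappa$-Knaster partial order of cardinality at most $\kappa$ is $\kappa$-stationarily layered. Then (i) $\kappa$ is a Mahlo cardinal, and (ii) every stationary subset of $\kappa$ reflects, i.e. for every stationary $S\subseteq\kappa$ there is a limit ordinal $\alpha<\kappa$ such that $S\cap\alpha$ is stationary in $\alpha$.
   Context: $\mathbb{P}$ is $\kappa$-Knaster if every $\kappa$-sized set of conditions has a $\kappa$-sized subset of pairwise compatible conditions. A suborder $\mathbb{Q}\subseteq\mathbb{P}$ is a regular suborder if the inclusion map preserves incompatibility and every maximal antichain of $\mathbb{Q}$ is maximal in $\mathbb{P}$. $\mathrm{Reg}_\kappa(\mathbb{P})$ is the set of regular suborders of $\mathbb{P}$ of cardinality less than $\kappa$. $\mathbb{P}$ is $\kappa$-stationarily layered if $\mathrm{Reg}_\kappa(\mathbb{P})$ is stationary in $\mathcal{P}_\kappa(\mathbb{P})$, stationarity in Jech's sense: $S\subseteq\mathcal{P}_\kappa(A)$ is stationary if it meets every $C\subseteq\mathcal{P}_\kappa(A)$ that is $\subseteq$-cofinal and closed under unions of $\subseteq$-increasing chains of length less than $\kappa$. *)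

(* Defs.v *)
From mathcomp Require Import all_boot all_order.
From mathcomp Require Import boolp classical_sets functions cardinality.

Set Implicit Arguments.
Unset Strict Implicit.
Unset Printing Implicit Defensive.

Import Order.TTheory.

Local Open Scope classical_set_scope.
Local Open Scope order_scope.
Local Open Scope card_scope.

Definition card_lt T U (A : set T) (B : set U) : Prop := A #<= B /\ ~ (B #<= A).

(* A cardinal kappa is represented by a well-ordered type K of order type
   kappa: the ordinals below kappa are the elements of K, an ordinal a < kappa
   is identified with the set [seg a] of its predecessors, and kappa itself is
   [set: K].  In the definitions below [D : set K] is meant to be an initial
   segment of K, i.e. an ordinal at most kappa. *)

Section Ordinals.
Context {d : Order.disp_t} {K : orderType d}.

Definition seg (a : K) : set K := [set x | x < a].

Definition limit_ordinal (a : K) : Prop :=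
  seg a !=set0 /\ forall b, b < a -> exists c, b < c /\ c < a.

Definition cofinal (D A : set K) : Prop :=
  A `<=` D /\ forall x, D x -> exists2 y, A y & x <= y.

Definition initial_ordinal (D : set K) : Prop :=
  forall a, D a -> card_lt (seg a) D.

Definition regular_cardinal (D : set K) : Prop :=
  [/\ infinite_set D, initial_ordinal D &
      forall A, cofinal D A -> A #= D].

Definition strong_limit (D : set K) : Prop :=
  forall a, D a -> card_lt [set B : set K | B `<=` seg a] D.

Definition inaccessible (D : set K) : Prop :=
  [/\ ~ countable D, regular_cardinal D & strong_limit D].

(* For limit a, [cofinal (seg a) (C `&` seg a)] says that C is unbounded in
   a. *)
Definition club (D C : set K) : Prop :=
  cofinal D C /\
  forall a, D a -> limit_ordinal a -> cofinal (seg a) (C `&` seg a) -> C a.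

Definition stationary (D S : set K) : Prop :=
  S `<=` D /\ forall C, club D C -> S `&` C !=set0.

End Ordinals.

Definition uncountable_regular d (K : orderType d) : Prop :=
  [/\ well_founded (fun x y : K => x < y), ~ countable [set: K] &
      regular_cardinal [set: K]].

Definition mahlo d (K : orderType d) : Prop :=
  [/\ well_founded (fun x y : K => x < y), inaccessible [set: K] &
      stationary [set: K] [set a : K | regular_cardinal (seg a)]].

Definition reflects d (K : orderType d) (S : set K) : Prop :=
  exists a, limit_ordinal a /\ stationary (seg a) (S `&` seg a).

Section StationarySubsetsOfPkappa.
Context {d : Order.disp_t} (K : orderType d) {T : Type}.

Definition Pkappa : set (set T) := [set A | card_lt A [set: K]].

(* A chain of length l < kappa is given by the values c i for i < l.  The
   length is required to be nonzero: the empty union is not a closure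
   condition, as otherwise every club would have to contain the empty set. *)
Definition chain_closed (C : set (set T)) : Prop :=
  forall (l : K) (c : K -> set T),
    seg l !=set0 ->
    (forall i, i < l -> C (c i)) ->
    (forall i j, i <= j -> j < l -> c i `<=` c j) ->
    C (\bigcup_(i in seg l) c i).

Definition Pkappa_club (C : set (set T)) : Prop :=
  [/\ C `<=` Pkappa,
      forall A, Pkappa A -> exists2 B, C B & A `<=` B &
      chain_closed C].

Definition Pkappa_stationary (S : set (set T)) : Prop :=
  S `<=` Pkappa /\ forall C, Pkappa_club C -> S `&` C !=set0.

End StationarySubsetsOfPkappa.

Section PartialOrders.
Context {e : Order.disp_t} {P : porderType e}.

Definition compatible (Q : set P) (p q : P) : Prop :=
  exists r, [/\ Q r, r <= p & r <= q].

Definition antichain (Q A : set P) : Prop :=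
  A `<=` Q /\ forall p q, A p -> A q -> p <> q -> ~ compatible Q p q.

Definition maximal_antichain (Q A : set P) : Prop :=
  antichain Q A /\ forall B, antichain Q B -> A `<=` B -> B = A.

Definition regular_suborder (Q : set P) : Prop :=
  (forall p q, Q p -> Q q -> ~ compatible Q p q -> ~ compatible [set: P] p q) /\
  (forall A, maximal_antichain Q A -> maximal_antichain [set: P] A).

End PartialOrders.

Definition Reg d (K : orderType d) e (P : porderType e) : set (set P) :=
  [set Q | regular_suborder Q /\ card_lt Q [set: K]].
Arguments Reg {d} K {e} P.

Definition Knaster d (K : orderType d) e (P : porderType e) : Prop :=
  forall A : set P, A #= [set: K] ->
    exists B : set P, [/\ B `<=` A, B #= [set: K] &
      forall p q, B p -> B q -> compatible [set: P] p q].

Definition stationarily_layered d (K : orderType d) e (P : porderType e) : Prop :=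
  Pkappa_stationary K (Reg K P).

(* Main.v *)
(** Given a bipartite graph between tops [b : K] and nodes [x], let P be the
    poset of finite independent sets of vertices, ordered by reverse inclusion.
    If for every limit [a] the top [a] has, whatever finitely many tops below
    [a] are chosen, a neighbour below [a] which is adjacent to none of them,
    then the conditions of level below [a] form no regular suborder: those
    incompatible with [{a}] are dense among them.  These layers form a club, so
    P is not stationarily layered, and any such graph for which P is Knaster is
    contradictory.  Failures of the conclusion yield such graphs:
    - if [2^a >= kappa], tops code distinct subsets of [a], and the nodes are
      finite partial functions on [a], adjacent to the tops they approximate;
    - if a club E contains no regular cardinal, a limit [b] gets an unbounded
      subset [C_b] above some [m_b < b], which is disjoint from E if [b] is not
      in E, and carries an injection [f_b] into [m_b] if [b] is in E; [b] is
      adjacent to the pairs [(c, f_b c)] with [c] in [C_b];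
    - if S does not reflect, each limit [b] has a club [C_b] missing S, and [b]
      is adjacent to the pairs [(c, C_b `&` seg c)] with [c] in [C_b].
    In the last two cases P is Knaster by Fodor's lemma: at points of a
    stationary set each node carries a regressive label which almost
    determines it among the neighbours of a given top. *)
Require Import Defs.
From HB Require Import structures.
From mathcomp Require Import all_boot all_order.
From mathcomp Require Import boolp classical_sets functions cardinality wochoice.

Set Implicit Arguments.
Unset Strict Implicit.
Unset Printing Implicit Defensive.

Import Order.TTheory.

(** * Cardinal comparison through injections, and induction on finite sets *)

Section Cardinals.
Local Open Scope classical_set_scope.
Local Open Scope card_scope.

Lemma fun_card_le T U (A : set T) (B : set U) (f : T -> U) :
  (forall x, A x -> B (f x)) ->
  (forall x y, A x -> A y -> f x = f y -> x = y) -> A #<= B.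
Proof.
move=> AB finj; have /injfunPex[g] : exists2 f : T -> U, set_fun A B f & set_inj A f.
  by exists f => // x y; rewrite !inE => *; exact: finj.
exact: inj_card_le g.
Qed.

Lemma card_le_fun T U (A : set T) (B : set U) : A !=set0 -> A #<= B ->
  exists f : T -> U, (forall x, A x -> B (f x)) /\
    forall x y, A x -> A y -> f x = f y -> x = y.
Proof.
move=> [a0 Aa0]; elim/Ppointed: U => U in B *.
  by rewrite [B]emptyE card_le0 => /eqP A0; rewrite A0 in Aa0.
move=> /pcard_leP[f]; exists f; split=> [x Ax|x y Ax Ay fxy]; first exact: funS.
by apply: (@inj _ _ A f) => //; rewrite inE.
Qed.

Lemma finite_set_elim T (Q : set T -> Prop) : Q set0 ->
  (forall x A, finite_set A -> Q A -> Q (x |` A)) ->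
  forall A, finite_set A -> Q A.
Proof.
move=> Q0 QU A [n]; elim: n A => [|n IH] A.
  by rewrite II0 card_eq0 => /eqP->.
move=> /eq_cardSP[x Ax An]; rewrite -(setD1K Ax); apply: QU; last exact: IH.
by exists n.
Qed.

End Cardinals.

(** * Sets of cardinality below the regular cardinal kappa *)

Section RegularCardinal.
Local Open Scope classical_set_scope.
Local Open Scope order_scope.
Local Open Scope card_scope.
Context {d : Order.disp_t} {K : orderType d} (hK : uncountable_regular K).

(** A negative form of [|A| < kappa] that passes at once to subsets and images; [small_card_lt]
    recovers [card_lt]. *)
Definition small T (A : set T) := ~ ([set: K] #<= A).

Lemma least (P : set K) : P !=set0 -> exists2 x, P x & forall y, P y -> x <= y.
Proof.
have [wf _ _] := hK; move=> [x]; elim/(well_founded_induction wf): x => x IH Px.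
have [[y [Py yx]]|nex] := pselect (exists y, P y /\ y < x); first exact: (IH y).
exists x => // y Py; rewrite leNgt; apply/negP => yx; apply: nex; by exists y.
Qed.

Lemma K_nonempty : [set: K] !=set0.
Proof. by have [_ _ [/infinite_setN0]] := hK. Qed.

Lemma card_le_small T U (A : set T) (B : set U) : A #<= B -> small B -> small A.
Proof. by move=> AB sB KA; apply: sB; exact: card_le_trans KA AB. Qed.

Lemma sub_small T (A B : set T) : A `<=` B -> small B -> small A.
Proof. by move=> AB; apply: card_le_small; exact: subset_card_le. Qed.

Lemma small_image T U (f : T -> U) (A : set T) : small A -> small (f @` A).
Proof. by apply: card_le_small; exact: card_image_le. Qed.

Lemma cofinal_card (A : set K) : (forall b, exists2 x, A x & b <= x) ->
  A #= [set: K].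
Proof. by have [_ _ [_ _ reg]] := hK => ub; apply: reg; split => // x _; exact: ub. Qed.

Lemma small_bounded (A : set K) : small A -> exists b, forall x, A x -> x < b.
Proof.
move=> sA; apply: contrapT => nb; apply: sA.
suff /card_eqPle[_] : A #= [set: K] by [].
apply: cofinal_card => b.
apply: contrapT => nex; apply: nb; exists b => x Ax; rewrite ltNge; apply/negP => bx.
by apply: nex; exists x.
Qed.

Lemma small_seg (a : K) : small (seg a).
Proof. by have [_ _ [_ /(_ a I)[]]] := hK. Qed.

Lemma small_nat : small [set: nat].
Proof. by have [_ unc _] := hK. Qed.

Lemma gt_ex (a : K) : exists b, a < b.
Proof.
apply: contrapT => nex; have [_ _ [inf _ _]] := hK; apply: inf.
suff /eq_finite_set <- : [set a] #= [set: K] by exact: finite_set1.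
apply: cofinal_card => b; exists a => //; rewrite leNgt; apply/negP => ab.
by apply: nex; exists b.
Qed.

Lemma finite_small T (A : set T) : finite_set A -> small A.
Proof. by move=> /finite_set_countable cA; exact: card_le_small cA small_nat. Qed.

(** If [f] injects K into the union, send [x] to an index [i x] of a piece containing [f x]. Each
    fibre of [i] is small, hence bounded by some [b j], and these bounds lie below a single [c];
    then [c < b (i c) < c]. *)
Lemma small_bigcup J T (D : set J) (F : J -> set T) :
  small D -> (forall i, D i -> small (F i)) -> small (\bigcup_(i in D) F i).
Proof.
move=> sD sF /(card_le_fun K_nonempty)[f [fF finj]].
have /choice[i iP] : forall x : K, exists i, D i /\ F i (f x).
  by move=> x; have [i Di Fi] := fF x I; exists i.
have /choice[b bP] : forall j, exists b : K, forall x, i x = j -> x < b.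
  move=> j; apply: small_bounded.
  have [Dj|nDj] := pselect (D j).
    apply: card_le_small (sF _ Dj); apply: (fun_card_le (f := f)).
      by move=> x /= <-; have [] := iP x.
    by move=> x y _ _; exact: finj.
  apply: (@sub_small _ _ set0); last exact/finite_small/finite_set0.
  by move=> x /= ij; apply: nDj; rewrite -ij; have [] := iP x.
have [c cP] := small_bounded (small_image (f := b) sD).
have : c < c; last by rewrite ltxx.
apply: lt_trans (cP _ (ex_intro2 _ _ (i c) _ erefl)); first exact: bP.
by have [] := iP c.
Qed.

Lemma small_setX T U (A : set T) (B : set U) :
  small A -> small B -> small (A `*` B).
Proof.
move=> sA sB; have := small_bigcup sA (fun x _ => small_image (f := pair x) sB).
by apply: sub_small => -[x y] [Ax By]; exists x => //; exists y.
Qed.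

Lemma small_finite_subsets T (Z : set T) :
  small Z -> small [set A | finite_set A /\ A `<=` Z].
Proof.
(* [F n] collects the sets obtained from the empty set by adding [n] points of [Z], repetitions
   allowed. The union over [n] stays small because kappa is uncountable. *)
move=> sZ; pose F := fix F n : set (set T) :=
  if n is m.+1 then \bigcup_(z in Z) [set z |` A | A in F m] else [set set0].
have sF n : small (F n).
  elim: n => [|n IH] /=; first exact/finite_small/finite_set1.
  by apply: small_bigcup => // z _; exact: small_image.
apply: sub_small (small_bigcup small_nat (fun n _ => sF n)).
move=> A [finA]; move: A finA.
apply: finite_set_elim => [_|x A finA IH AZ]; first by exists 0%N.
have [|n _ Fn] := IH; first by move=> y Ay; apply: AZ; right.
exists n.+1 => //; exists x; first by apply: AZ; left.
by exists A.
Qed.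

(* Mostowski collapse: [g x] is the least value not taken below [x]. *)
Lemma collapse U (r : U -> U -> Prop) : well_founded r ->
  exists g : U -> K, forall x, (exists k, forall y, r y x -> g y <> k) ->
    (forall y, r y x -> g y <> g x) /\
    forall k, k < g x -> exists2 y, r y x & g y = k.
Proof.
move=> rwf; have /choice[mex mexP] : forall P : set K, exists m,
    (exists k, ~ P k) -> ~ P m /\ forall k, k < m -> P k.
  move=> P; have [/least[m nPm mP]|nex] := pselect (exists k, ~ P k).
    exists m => _; split=> // k km; apply: contrapT => /mP.
    by rewrite leNgt km.
  by have [m _] := K_nonempty; exists m.
pose step x (rec : forall y, r y x -> K) : K :=
  mex [set k | exists y (h : r y x), rec y h = k].
pose g := Fix rwf (fun=> K) step.
have gE x : g x = mex [set k | exists2 y, r y x & g y = k].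
  rewrite /g Fix_eq => [|{}x f f' ff']; last first.
    congr (step x _); apply: functional_extensionality_dep => y.
    by apply: functional_extensionality_dep => ryx.
  congr mex; apply/seteqP; split=> k /=; first by move=> [y [h <-]]; exists y.
  by move=> [y h <-]; exists y, h.
exists g => x [k gk].
have [|nP gP] := mexP [set k | exists2 y, r y x & g y = k].
  by exists k => -[y /gk].
rewrite -gE in nP gP; split=> // y ryx gyx; apply: nP; by exists y.
Qed.

(* Compared by [lev] and then by a well-order, A has only small initial
   segments, so the collapse is injective. *)
Lemma small_filtration T (A : set T) (lev : T -> K) :
  (forall a, small [set x | A x /\ lev x < a]) -> A #<= [set: K].
Proof.
move=> slev; have [R Rwo] := well_ordering_principle {classic T}.
have Rasym := in2T (wo_chain_antisymmetric (withinW (A := predT) Rwo)).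
pose r (y x : T) := A y /\ (lev y < lev x \/ lev y = lev x /\ ~~ R x y).
have rwf : well_founded r.
  move=> x; apply: contrapT => nx.
  (* Among the non-accessible points, take the least level, and then the [R]-least point [w] of that
     level. *)
  have [_ [z nz <-] zmin] := least (P := [set lev x | x in [set x | ~ Acc r x]])
    (ex_intro _ _ (ex_intro2 _ _ x nx erefl)).
  have [|w [[/asboolP[nw wz] wmin] _]] := Rwo (fun x => `[< ~ Acc r x /\ lev x = lev z >]).
    by exists z; apply/asboolP.
  apply: nw; constructor=> y [_ [ylt|[yw nRyw]]].
    apply: contrapT => ny; have := zmin _ (ex_intro2 _ _ y ny erefl).
    by rewrite leNgt -wz ylt.
  apply: contrapT => ny; apply: (negP nRyw).
  by apply: (wmin y); apply/asboolP; rewrite yw.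
have [g gP] := collapse rwf.
have gr x y : A y -> r y x -> g y <> g x.
  move=> Ay ryx; have [|nr _] := gP x; last exact: nr.
  have [b xb] := gt_ex (lev x).
  (* All predecessors of [x] lie in [A] below level [b], so their values cannot exhaust K, as
     [collapse] requires. *)
  have : small (g @` [set y | A y /\ lev y < b]) by apply: small_image.
  move=> sim; apply: contrapT => nex; apply: sim.
  apply: subset_card_le => k _; apply: contrapT => nk; apply: nex; exists k.
  move=> z [Az rzx] gz; apply: nk; exists z => //; split=> //.
  by case: rzx => [/lt_trans|[->]]; last move=> _; [apply|].
apply: (fun_card_le (f := g)) => // x y Ax Ay gxy; apply: contrapT => xy.
have [ltxy|ltyx|eqxy] := ltgtP (lev x) (lev y).
- by apply: (gr y x) => //; split=> //; left.
- by apply: (gr x y) => //; split=> //; left.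
- have [Rxy|nRxy] := boolP (R x y); last first.
    by apply: (gr x y) => //; split=> //; right.
  have [Ryx|nRyx] := boolP (R y x); last first.
    by apply: (gr y x) => //; split=> //; right.
  by apply: xy; apply: Rasym; rewrite Rxy.
Qed.

Lemma small_card_le T (A : set T) : small A -> A #<= [set: K].
Proof.
have [k _] := K_nonempty => sA; apply: (small_filtration (lev := fun=> k)) => a.
by apply: sub_small sA => x [].
Qed.

Lemma small_card_lt T (A : set T) : small A -> card_lt A [set: K].
Proof. by move=> sA; split; first exact: small_card_le. Qed.

End RegularCardinal.

Arguments small_seg {d K} hK a _.

(** * Clubs, stationary sets and Fodor's lemma *)

Section Stationary.
Local Open Scope classical_set_scope.
Local Open Scope order_scope.
Local Open Scope card_scope.
Context {d : Order.disp_t} {K : orderType d} (hK : uncountable_regular K).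
Local Notation least := (least hK).
Local Notation gt_ex := (gt_ex hK).

Lemma bottom_ex : exists b : K, forall x, b <= x.
Proof. by have [b _ bP] := least (K_nonempty hK); exists b => x; exact: bP. Qed.

Lemma sup_ex (A : set K) : (exists b, forall x, A x -> x <= b) ->
  exists s, (forall x, A x -> x <= s) /\ forall y, y < s -> exists2 x, A x & y < x.
Proof.
move=> /least[s ub lub]; exists s; split=> // y ys; apply: contrapT => nex.
suff /lub : forall x, A x -> x <= y by rewrite leNgt ys.
by move=> x Ax; rewrite leNgt; apply/negP => yx; apply: nex; exists x.
Qed.

Lemma limit_lt_max (a x y : K) : limit_ordinal a -> x < a -> y < a ->
  exists z, [/\ z < a, x < z & y < z].
Proof.
move=> [_ lim] xa ya; have [|z [lz za]] := lim (Order.max x y).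
  by rewrite gt_max xa.
by move: lz; rewrite gt_max => /andP[xz yz]; exists z.
Qed.

Lemma finite_strict_bound (a : K) T (f : T -> K) (A : set T) :
  limit_ordinal a -> finite_set A -> (forall x, A x -> f x < a) ->
  exists2 b, b < a & forall x, A x -> f x < b.
Proof.
move=> lima; move: A; apply: finite_set_elim => [_|x A _ IH fA].
  by have [[b ba] _] := lima; exists b.
have [y Ay|b ba fb] := IH; first by apply: fA; right.
have [z [za xz bz]] := limit_lt_max lima (fA x (or_introl erefl)) ba.
exists z => // y [->//|Ay]; exact: lt_trans (fb y Ay) bz.
Qed.

(** Every club contains one of this form ([club_closed_under]), so stationarity need only be tested
    against functions. *)
Definition closed_under (h : K -> K) : set K :=
  [set a | limit_ordinal a /\ forall x, x < a -> h x < a].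

Lemma closed_under_club (h : K -> K) : club [set: K] (closed_under h).
Proof.
split; last first.
  move=> a _ lima [_ cof]; split=> // x xa.
  have [_ lim] := lima; have [y [xy ya]] := lim x xa.
  have [c [[_ hc] ca] yc] := cof y ya.
  exact: lt_trans (hc _ (lt_le_trans xy yc)) ca.
split=> // x0 _.
have /choice[k kP] : forall x, exists k, x < k /\ forall y, y <= x -> h y < k.
  move=> x; have [b xb] := gt_ex x.
  have [c cP] := small_bounded hK (small_image (f := h) (small_seg hK b)).
  exists (Order.max b c); rewrite lt_max xb; split=> // y yx.
  rewrite lt_max cP ?orbT //; exists y => //; exact: le_lt_trans yx xb.
(* The required point above [x0] is the supremum of these iterates, which are bounded since kappa is
   regular and uncountable. *)
pose f n := iter n k x0.
have [b bP] := small_bounded hK (small_image (f := f) (small_nat hK)).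
have [|s [ub lub]] := @sup_ex (range f).
  by exists b => x fx; exact/ltW/bP.
have fs n : f n < s.
  by apply: (@lt_le_trans _ _ (f n.+1)); [have [] := kP (f n)|apply: ub; exists n.+1].
exists s; last exact/ltW/(fs 0%N).
split=> [|y /lub[_ [n _ <-] yn]]; first split.
- by exists x0; exact: (fs 0%N).
- by move=> c /lub[_ [n _ <-] cn]; exists (f n); split.
- by apply: lt_trans (fs n.+1); have [_] := kP (f n); apply; exact: ltW.
Qed.

(** The bound [h x] exists because few [y] have level at most [x]. If [a] is closed under [h] and
    [lev y < a], then [E y] is unbounded in [a]: for [x < a], the point [e (y, m)] of [E y] with
    [m = max x (lev y)] is above [x] and below [h m < a]. *)
Lemma diagonal_intersection T (V : set T) (lev : T -> K) (E : T -> set K) :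
  (forall a, small (K := K) [set y | V y /\ lev y < a]) ->
  (forall y, V y -> club [set: K] (E y)) ->
  exists h, forall a, closed_under h a -> forall y, V y -> lev y < a -> E y a.
Proof.
move=> slev clubE.
have /choice[e eP] : forall yx : T * K, exists c, V yx.1 -> E yx.1 c /\ yx.2 < c.
  move=> [y x] /=; have [Vy|nVy] := pselect (V y); last by exists x.
  have [[_ cof] _] := clubE y Vy; have [z xz] := gt_ex x.
  by have [c Ec zc] := cof z I; exists c => _; split=> //; exact: lt_le_trans zc.
have /choice[h hP] : forall x, exists b, forall y, V y -> lev y <= x -> e (y, x) < b.
  move=> x; have [z xz] := gt_ex x.
  have [b bP] := small_bounded hK (small_image (f := fun y => e (y, x)) (slev z)).
  exists b => y Vy yx; apply: bP; exists y => //; split=> //.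
  exact: le_lt_trans yx xz.
exists h => a [lima ha] y Vy ya; have [_] := clubE y Vy; apply=> //.
split=> [c []//|x xa].
pose m := Order.max x (lev y); have ma : m < a by rewrite gt_max xa.
have [Ee me] := eP (y, m) Vy; exists (e (y, m)); last first.
  by apply: ltW; apply: le_lt_trans me; rewrite le_max lexx.
split=> //=; apply: lt_trans (ha m ma); apply: hP => //.
by rewrite le_max lexx orbT.
Qed.

(** A diagonal intersection with one member, placed at the bottom level so as to lie below every
    limit ordinal. *)
Lemma club_closed_under (C : set K) : club [set: K] C ->
  exists h, closed_under h `<=` C.
Proof.
move=> clubC; have [b bP] := bottom_ex.
have [||h hP] := @diagonal_intersection unit setT (fun=> b) (fun=> C) => //.
  by move=> a; exact/finite_small/finite_finset.
exists h => a ha; apply: (hP a ha tt) => //.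
by case: ha => -[[x xa] _] _; exact: le_lt_trans xa.
Qed.

Lemma stationaryP (S : set K) :
  stationary [set: K] S <-> forall h, exists2 a, S a & closed_under h a.
Proof.
split=> [[_ St] h|St].
  by have [a [Sa ha]] := St _ (closed_under_club h); exists a.
split=> // C /club_closed_under[h hC].
by have [a Sa /hC Ca] := St h; exists a.
Qed.

Lemma stationary_setT : stationary [set: K] [set: K].
Proof.
apply/stationaryP => h; have [[_ cof] _] := closed_under_club h.
by have [x _] := K_nonempty hK; have [a ha _] := cof x I; exists a.
Qed.

Lemma stationary_closed_under (S : set K) h :
  stationary [set: K] S -> stationary [set: K] (S `&` closed_under h).
Proof.
move=> /stationaryP St; apply/stationaryP => h'.
have [a Sa [lima ha]] := St (fun x => Order.max (h x) (h' x)).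
by exists a; [split=> //|]; split=> // x /ha; rewrite gt_max => /andP[].
Qed.

Lemma stationary_setI_limit (S : set K) :
  stationary [set: K] S -> stationary [set: K] (S `&` [set a | limit_ordinal a]).
Proof.
move=> /stationaryP St; apply/stationaryP => h.
by have [a Sa ha] := St h; exists a => //; split=> //; case: ha.
Qed.

Lemma stationary_gt (S : set K) b :
  stationary [set: K] S -> stationary [set: K] (S `&` [set a | b < a]).
Proof.
move=> /(stationary_closed_under (fun=> b))/stationaryP St; apply/stationaryP => h.
have [a [Sa [lima ha]] h'a] := St h; exists a => //; split=> //=.
by have [[x xa] _] := lima; exact: ha xa.
Qed.

Lemma stationary_card (S : set K) : stationary [set: K] S -> S #= [set: K].
Proof.
move=> St; apply: (cofinal_card hK) => b.
have /stationaryP/(_ id)[a [Sa ba] _] := stationary_gt b St.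
by exists a => //; exact: ltW.
Qed.

(** Values are graded by [lev] instead of being ordinals, so that finite sets can serve as values.
    If each fibre missed a club [E y], a point [a] of [S] in the diagonal intersection would lie in
    [E (g a)]. *)
Lemma fodor T (V : set T) (lev : T -> K) (S : set K) (g : K -> T) :
  (forall a, small (K := K) [set y | V y /\ lev y < a]) ->
  stationary [set: K] S -> (forall a, S a -> V (g a) /\ lev (g a) < a) ->
  exists y, stationary [set: K] (S `&` [set a | g a = y]).
Proof.
move=> slev St gS; apply: contrapT => nex.
have /choice[E EP] : forall y, exists C, club [set: K] C /\
    forall a, S a -> C a -> g a <> y.
  move=> y; apply: contrapT => nC; apply: nex; exists y; split=> // C clubC.
  apply: contrapT => ne; apply: nC; exists C; split=> // a Sa Ca gay; apply: ne.
  by exists a.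
have [|h hP] := diagonal_intersection slev (E := E).
  by move=> y _; have [] := EP y.
have /stationaryP/(_ h)[a Sa ha] := St.
have [Vg lg] := gS a Sa; have [_ /(_ a Sa)] := EP (g a).
by apply=> //; exact: hP.
Qed.

Lemma fodor_ord (S : set K) (g : K -> K) : stationary [set: K] S ->
  (forall a, S a -> g a < a) ->
  exists y, stationary [set: K] (S `&` [set a | g a = y]).
Proof.
move=> St gS; apply: (@fodor _ setT id) => [a||a /gS] //.
by apply: sub_small (small_seg hK a) => x [].
Qed.

(** Finitely many levels below a limit [a] are bounded below [a]. Hence the finite set [G a], graded
    by its least strict bound [sup], is itself a regressive value. *)
Lemma fodor_finite T (V : set T) (lev : T -> K) (S : set K) (G : K -> set T) :
  (forall a, small (K := K) [set y | V y /\ lev y < a]) ->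
  stationary [set: K] S ->
  (forall a, S a -> [/\ limit_ordinal a, finite_set (G a) &
     forall y, G a y -> V y /\ lev y < a]) ->
  exists A, stationary [set: K] (S `&` [set a | G a = A]).
Proof.
move=> slev St GS; have [b0 _] := bottom_ex.
have /choice[sup supP] : forall A : set T, exists s, forall b,
    (forall y, A y -> lev y < b) -> s <= b /\ forall y, A y -> lev y < s.
  move=> A; have [/least[s As sle]|nb] :=
    pselect (exists b, forall y, A y -> lev y < b); last first.
    by exists b0 => b /(ex_intro _ _)/nb.
  by exists s => b /sle.
apply: (@fodor _ [set A | finite_set A /\ forall y, A y -> V y /\ lev y < sup A] sup) => //.
- move=> a; apply: sub_small (small_finite_subsets hK (slev a)).
  move=> A [[finA VA] sa]; split=> // y /VA[Vy ys]; split=> //; exact: lt_trans sa.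
- move=> a /GS[lima finG Gb].
  have [y /Gb[]//|b ba Gyb] := finite_strict_bound lima (f := lev) finG.
  have [sb Gs] := supP _ _ Gyb; split; last exact: le_lt_trans ba.
  by split=> // y Gy; split; [have [] := Gb y Gy|exact: Gs].
Qed.

End Stationary.

(** * Families of sets ordered by reverse inclusion *)

Fact family_display : Order.disp_t. Proof. exact: Order.Disp tt tt. Qed.

Section Family.
Local Open Scope classical_set_scope.
Context {X : Type} (ok : set (set X)).

(* The members of [ok] as forcing conditions: a larger set is stronger. *)
Definition family : Type := {p : set X | `[< ok p >]}.

HB.instance Definition _ := SubType.on family.
HB.instance Definition _ := [Choice of family by <:].

Definition family_le (p q : family) := `[< val q `<=` val p >].

Lemma family_le_refl : reflexive family_le.
Proof. by move=> p; apply/asboolP. Qed.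

Lemma family_le_anti : antisymmetric family_le.
Proof. by move=> p q /andP[/asboolP qp /asboolP pq]; apply/val_inj/seteqP. Qed.

Lemma family_le_trans : transitive family_le.
Proof.
by move=> q p r /asboolP qp /asboolP rq; apply/asboolP; exact: subset_trans qp.
Qed.

HB.instance Definition _ := Order.Le_isPOrder.Build family_display family
  family_le_refl family_le_anti family_le_trans.

Lemma family_ok (p : family) : ok (val p).
Proof. by apply/asboolP; exact: (valP p). Qed.

Definition mk_family (p : set X) (okp : ok p) : family := exist _ p (asboolT okp).

End Family.

(** * The poset of finite independent sets of a bipartite graph *)

Section IndependentSets.
Local Open Scope classical_set_scope.
Local Open Scope order_scope.
Local Open Scope card_scope.
Context {d : Order.disp_t} {K : orderType d} (hK : uncountable_regular K).
Context {N : Type} (V : set N) (lev : N -> K) (edge : K -> N -> Prop).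
Context (small_lev : forall a, small (K := K) [set x | V x /\ lev x < a]).

Definition level (v : K + N) : K := match v with inl b => b | inr x => lev x end.

Definition vertex : set (K + N) :=
  [set v | match v with inl _ => True | inr x => V x end].

Definition independent : set (set (K + N)) :=
  [set p | [/\ finite_set p, p `<=` vertex &
    forall b x, p (inl b) -> p (inr x) -> ~ edge b x]].

Local Notation P := (family independent).

Lemma small_level a : small (K := K) [set v | vertex v /\ level v < a].
Proof.
apply: (@sub_small _ _ _ _ (\bigcup_(c in [set: bool])
  (if c then inl @` seg a else inr @` [set x | V x /\ lev x < a]))); last first.
  apply: (small_bigcup hK) => [|[] _]; first exact/(finite_small hK)/finite_finset.
    by apply: small_image; exact: small_seg.
  exact: small_image.
move=> [b|x] [Vx xa]; first by exists true => //; exists b.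
by exists false => //; exists x.
Qed.

Lemma level_bound (p : P) : exists b, forall v, val p v -> level v < b.
Proof.
have [finp _ _] := family_ok p.
have [b bP] := small_bounded hK (small_image (f := level) (finite_small hK finp)).
by exists b => v pv; apply: bP; exists v.
Qed.

Definition layer (a : K) : set P := [set p | forall v, val p v -> level v < a].

Lemma small_layer a : small (K := K) (layer a).
Proof.
apply: card_le_small (small_finite_subsets hK (small_level (a := a))).
apply: (fun_card_le (f := val)) => [p pa|p q _ _]; last exact: val_inj.
have [finp Vp _] := family_ok p; split=> // v pv.
by split; [exact: Vp|exact: pa].
Qed.

Lemma independent_card : [set: P] #<= [set: K].
Proof.
have /choice[bnd bndP] := level_bound; apply: (small_filtration hK (lev := bnd)) => a.
by apply: sub_small (small_layer (a := a)) => p [_ pa] v /bndP/lt_trans; apply.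
Qed.

Lemma finite_tops (p : P) : finite_set [set b | val p (inl b)].
Proof.
have [k _] := K_nonempty hK; have [finp _ _] := family_ok p.
apply: sub_finite_set (finite_image (fun v => if v is inl b then b else k) finp).
by move=> b pb; exists (inl b).
Qed.

Lemma layer_club : Pkappa_club K [set layer a | a in limit_ordinal].
Proof.
split=> [_ [a _ <-]|A [_ sA]|l c [i0 i0l] Cc cmono].
- exact/(small_card_lt hK)/small_layer.
- have /choice[bnd bndP] := level_bound.
  have [b bP] := small_bounded hK (small_image (f := bnd) sA).
  have [[_ /(_ b I)[a [lima ha] ba]] _] := closed_under_club hK (fun=> b).
  have {}ba : b < a by have [[x xa] _] := lima; exact: ha xa.
  exists (layer a); first by exists a.
  move=> p Ap v /bndP vp; apply: lt_trans ba; apply: lt_trans vp _.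
  by apply: bP; exists p.
- have /choice[a aP] : forall i, exists a, i < l -> limit_ordinal a /\ layer a = c i.
    move=> i; have [il|nil] := boolP (i < l); last by exists l.
    by have [a lima <-] := Cc i il; exists a.
  have [b bP] := small_bounded hK (small_image (f := a) (small_seg hK l)).
  (* The union of the chain is [layer s]: the levels of a condition are finitely many, so those
     below the limit [s] already lie below some [a i]. *)
  have [|s [ub lub]] := sup_ex hK (A := a @` seg l).
    by exists b => x ax; exact/ltW/bP.
  have as_ i : i < l -> a i <= s by move=> il; apply: ub; exists i.
  have lims : limit_ordinal s.
    split=> [|x /lub[_ [i il <-] xi]].
      have [[[x xa] _] _] := aP i0 i0l; exists x; exact: lt_le_trans xa (as_ _ i0l).
    have [[_ /(_ x xi)[y [xy yi]]] _] := aP i il.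
    by exists y; split=> //; exact: lt_le_trans yi (as_ _ il).
  exists s => //; apply/seteqP; split=> p.
    move=> ps; have [finp _ _] := family_ok p.
    have [b' /lub[_ [i il <-] b'i] pb'] := finite_strict_bound lims finp ps.
    exists i => //; have [_ <-] := aP i il.
    by move=> v pv; exact: lt_trans (pb' v pv) b'i.
  move=> [i il]; have [_ <-] := aP i il => pa v /pa vi.
  exact: lt_le_trans vi (as_ _ il).
Qed.

(** Some [layer a] would be regular. An antichain maximal inside the dense set [D] is maximal in
    this layer, hence in P, although the condition [t] is incompatible with all its members. *)
Lemma not_layered :
  (forall a F, limit_ordinal a -> finite_set F -> F `<=` seg a ->
    exists x, [/\ V x, lev x < a, edge a x & forall b, F b -> ~ edge b x]) ->
  ~ stationarily_layered K P.
Proof.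
move=> sep [_ /(_ _ layer_club)[Q [[[_ reg] _] [a lima eQ]]]].
have indt : independent [set inl a].
  by split=> [|v ->//|b x _ //]; exact: finite_set1.
pose t := mk_family indt.
pose D := [set r | Q r /\ ~ compatible [set: P] r t].
have dense q : Q q -> exists2 r, D r & r <= q.
  rewrite -eQ => Qq; have [finq Vq indq] := family_ok q.
  (* Adding to [q] a node adjacent to [a] but to no top of [q] gives an extension of [q]
     incompatible with [t]. *)
  have [|x [Vx xa ax nx]] := sep a _ lima (finite_tops q).
    by move=> b /Qq.
  have indr : independent (inr x |` val q).
    split=> [|v [->//|/Vq//]|b y [//|qb] [[->]|qy]].
    - by rewrite finite_setU; split=> //; exact: finite_set1.
    - exact: nx.
    - exact: indq.
  exists (mk_family indr); last by apply/asboolP => v qv; right.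
  split=> [|[w [_ /asboolP wr /asboolP wt]]].
    by rewrite -eQ => v [->//|/Qq].
  have [_ _ indw] := family_ok w; apply: (indw a x) => //; first exact: wt.
  by apply: wr; left.
(* Zorn's lemma inside [D]; by density, an element of [Q] incompatible with all of [A] would have an
   extension in [D] that could be added to [A]. *)
have [F FZ Ftot|A [[[AQ Aanti] AD] Amax]] :=
  @Zorn_bigcup P [set A | antichain Q A /\ A `<=` D].
  split; last by move=> p [A FA Ap]; have [_] := FZ A FA; apply.
  split=> [p [A FA Ap]|p q [A FA Ap] [B FB Bq]].
    by have [[AQ _] _] := FZ A FA; exact: AQ.
  have [[_ Aanti] _] := FZ A FA; have [[_ Banti] _] := FZ B FB.
  by have [AB|BA] := Ftot A B FA FB; [apply: Banti => //; exact: AB|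
    apply: Aanti => //; exact: BA].
have maxA : maximal_antichain Q A.
  split=> // B [BQ Banti] AB; apply/seteqP; split=> // b Bb.
  apply: contrapT => nAb; have [r Dr rb] := dense b (BQ b Bb).
  have rA p : A p -> ~ compatible Q p r.
    move=> Ap [w [Qw wp wr]]; apply: (Banti p b (AB p Ap) Bb).
      by move=> pb; apply: nAb; rewrite -pb.
    by exists w; split=> //; exact: le_trans wr rb.
  apply: (Amax (r |` A)).
    split=> [p Ap|rAA]; first by right.
    apply: (rA r); first by apply: rAA; left.
    by exists r; split=> //; case: Dr.
  split=> [|p [->//|/AD//]].
  split=> [p [->|/AQ//]|p q [->|Ap] [->|Aq] //]; first by case: Dr.
  - by move=> _ [w [Qw wr wq]]; apply: (rA q Aq); exists w; split.
  - by move=> _; exact: rA.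
  - exact: Aanti.
have [[_ Aanti'] Amax'] := reg A maxA.
suff At : A t by have [_ []] := AD t At; exists t; split.
rewrite -(Amax' (t |` A)); first by left.
  split=> // p q [->|Ap] [->|Aq] // pq; last exact: Aanti'.
    by move=> [w [_ wt wq]]; have [_ []] := AD q Aq; exists w; split.
  by move=> [w [_ wp wt]]; have [_ []] := AD p Ap; exists w; split.
by move=> p Ap; right.
Qed.

(* [lab xi x] is a regressive label of the node x, and a label v determines,
   below eta and for a fixed top b, the nodes adjacent to b up to a bound
   [< eta]. Fodor's lemma makes both the labels and the bounds constant. *)
Lemma independent_knaster (S : set K) (lab : K -> N -> K) :
  stationary [set: K] S ->
  (forall b x, V x -> edge b x -> lev x <= b) ->
  (forall a x, S a -> V x -> a <= lev x -> lab a x < a) ->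
  (forall c b v, S c -> c <= b -> v < c -> exists2 m, m < c &
    forall a x, S a -> a < c -> V x -> a <= lev x -> lev x < c ->
      lab a x = v -> edge b x -> a <= m) ->
  Knaster K P.
Proof.
move=> St edge_lev lab_lt lab_bound A /card_eqPle[_ KA].
have [f [fA finj]] := card_le_fun (K_nonempty hK) KA.
pose q a := val (f a).
have finq a : finite_set (q a) by have [] := family_ok (f a).
have Vq a : q a `<=` vertex by have [] := family_ok (f a).
have indq a b x : q a (inl b) -> q a (inr x) -> ~ edge b x.
  by have [_ _] := family_ok (f a); apply.
have /choice[h hP] : forall a, exists b, forall v, q a v -> level v < b.
  by move=> a; exact: level_bound.
(* Closure under [h] puts every [q a] with [a < c] below level [c]. *)
pose S0 := S `&` closed_under h.
have St0 : stationary [set: K] S0 by exact: stationary_closed_under.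
have ltq a c v : S0 c -> a < c -> q a v -> level v < c.
  by move=> [_ [_ hc]] ac /hP vh; apply: lt_trans vh _; exact: hc.
(* First uniformization: the part of [q a] below [a] becomes a constant root [R]. *)
pose old a := q a `&` [set v | level v < a].
have [|R St1] := fodor_finite hK small_level St0 (G := old).
  move=> a [Sa [lima _]]; split=> // [|v [qv va]]; first exact: finite_setIl.
  by split=> //; exact: Vq qv.
pose S1 := S0 `&` [set a | old a = R]; rewrite -/S1 in St1.
(* Second uniformization: the labels of the nodes of [q a] at level [a] or above form a constant set
   [L]. *)
pose labels a :=
  [set v | exists x, [/\ q a (inr x), a <= lev x & lab a x = v]].
have fin_labels a : finite_set (labels a).
  apply: sub_finite_set
    (finite_image (fun v => if v is inr x then lab a x else a) (finq a)).
  by move=> v [x [qx _ <-]]; exists (inr x).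
have labels_lt a v : S a -> labels a v -> v < a.
  by move=> Sa [x [qx ax <-]]; apply: lab_lt => //; exact: (Vq _ _ qx).
have [c|a [[Sa [lima _]] _]|L St2] :=
  @fodor_finite _ _ hK K setT id S1 labels _ St1.
- by apply: sub_small (small_seg hK c) => x [].
- by split=> // v /labels_lt; split=> //; auto.
pose S2 := S1 `&` [set a | labels a = L]; rewrite -/S2 in St2.
(* Third uniformization: [m c] dominates the bounds for the finitely many pairs of a top of [q c] at
   or above [c] and a label in [L]. It becomes a constant [M], and only points above [M] are
   kept. *)
have /choice[m mP] : forall c, exists m, S2 c -> m < c /\
    forall a b x, S a -> a < c -> V x -> a <= lev x -> lev x < c ->
      q c (inl b) -> c <= b -> L (lab a x) -> edge b x -> a <= m.
  move=> c; have [[[[Sc [limc _]] _] Lc]|nSc] := pselect (S2 c); last by exists c.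
  have /choice[e eP] : forall z : K * K, exists m, c <= z.1 -> z.2 < c -> m < c /\
      forall a x, S a -> a < c -> V x -> a <= lev x -> lev x < c ->
      lab a x = z.2 -> edge z.1 x -> a <= m.
    move=> [b v] /=; have [[cb vc]|nbv] := pselect (c <= b /\ v < c); last first.
      by exists c => cb vc; case: nbv.
    by have [m mc mP] := lab_bound c b v Sc cb vc; exists m.
  pose Z := ([set b | q c (inl b)] `*` labels c) `&` [set z | c <= z.1].
  have finZ : finite_set Z.
    by apply: finite_setIl; apply: finite_setX; [exact: finite_tops|].
  have [z [[_ /(labels_lt _ _ Sc) zc] cz]|m mc Zm] :=
    finite_strict_bound (f := e) limc finZ.
    by have [] := eP z cz zc.
  exists m => _; split=> // a b x Sa ac Vx ax xc qb cb Lx ebx.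
  have Lxc : labels c (lab a x) by rewrite Lc.
  apply: le_trans (ltW (Zm (b, lab a x) _)); last by split.
  have [_] := eP (b, lab a x) cb (labels_lt _ _ Sc Lxc).
  by move=> /(_ a x Sa ac Vx ax xc erefl ebx).
have [a /mP[]//|M St3] := fodor_ord hK (g := m) St2.
pose S3 := (S2 `&` [set a | m a = M]) `&` [set a | M < a].
have St4 : stationary [set: K] S3 by exact: stationary_gt.
exists (f @` S3); split.
- by move=> _ [a _ <-]; exact: fA.
- apply: card_eq_trans (stationary_card hK St4); apply: inj_card_eq.
  by move=> x y _ _; exact: finj.
suff compat a c : S3 a -> S3 c -> a < c -> compatible [set: P] (f a) (f c).
  move=> _ _ [a Sa <-] [c Sc <-]; have [ac|ca|->] := ltgtP a c.
  - exact: compat.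
  - by have [w [_ wc wa]] := compat c a Sc Sa ca; exists w; split.
  - by exists (f c); split.
move=> [[[[S0a Ra] La] ma] Ma] [[[[S0c Rc] Lc] mc] Mc] ac.
have [[Sa _] [Sc _]] := (S0a, S0c).
have to_c v : q a v -> level v < a -> q c v.
  by move=> qv va; have [] : old c v by rewrite Rc -Ra.
have to_a v : q c v -> level v < c -> q a v.
  by move=> qv vc; have [] : old a v by rewrite Ra -Rc.
(* A node of [q c] adjacent to a top of [q a] has level below [c], so it belongs to [q a]. For a top
   [b] of [q c] and a node [x] of [q a], either one of them lies in the root, or
   [a <= m c = M < a]. *)
have ind : independent (q a `|` q c).
  split=> [|v [/Vq//|/Vq//]|b x [qb|qb] [qx|qx] ebx].
  - by rewrite finite_setU.
  - exact: (indq a b x).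
  - have bc : b < c := ltq _ _ _ S0c ac qb.
    apply: (indq a b x) => //; apply: to_a => //=.
    by apply: le_lt_trans bc; apply: edge_lev ebx; exact: (Vq _ _ qx).
  - have xc : lev x < c := ltq _ _ _ S0c ac qx.
    have [bc|cb] := ltP b c; first by apply: (indq a b x) => //; exact: to_a.
    have [xa|ax] := ltP (lev x) a; first by apply: (indq c b x) => //; exact: to_c.
    have S2c : S2 c by split=> //; split.
    have [_ /(_ a b x Sa ac (Vq _ _ qx) ax xc qb cb)] := mP c S2c.
    have Lx : L (lab a x) by rewrite -La; exists x.
    by move=> /(_ Lx ebx); rewrite mc leNgt Ma.
  - exact: (indq c b x).
exists (mk_family ind); split=> //; apply/asboolP => v qv; [by left|by right].
Qed.

Lemma layered_contradiction (S : set K) (lab : K -> N -> K) :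
  (forall (e : Order.disp_t) (Q : porderType e),
     [set: Q] #<= [set: K] -> Knaster K Q -> stationarily_layered K Q) ->
  stationary [set: K] S ->
  (forall b x, V x -> edge b x -> lev x <= b) ->
  (forall a x, S a -> V x -> a <= lev x -> lab a x < a) ->
  (forall c b v, S c -> c <= b -> v < c -> exists2 m, m < c &
    forall a x, S a -> a < c -> V x -> a <= lev x -> lev x < c ->
      lab a x = v -> edge b x -> a <= m) ->
  ~ (forall a F, limit_ordinal a -> finite_set F -> F `<=` seg a ->
    exists x, [/\ V x, lev x < a, edge a x & forall b, F b -> ~ edge b x]).
Proof.
move=> layered St edge_lev lab_lt lab_bound /not_layered; apply.
by apply: layered; [exact: independent_card|exact: independent_knaster St _ _ lab_bound].
Qed.

End IndependentSets.

(** * Consequences of layering: kappa is a strong limit *)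

Section LayeredCardinals.
Local Open Scope classical_set_scope.
Local Open Scope order_scope.
Local Open Scope card_scope.
Context {d : Order.disp_t} {K : orderType d} (hK : uncountable_regular K).
Context (layered : forall (e : Order.disp_t) (Q : porderType e),
  [set: Q] #<= [set: K] -> Knaster K Q -> stationarily_layered K Q).

Lemma layered_strong_limit : strong_limit [set: K].
Proof.
move=> a _; apply: (small_card_lt hK) => KX.
have [X [Xa Xinj]] := card_le_fun (K_nonempty hK) KX.
have [b0 b0P] := bottom_ex hK.
pose V := [set F : set (K * bool) | finite_set F /\ F `<=` seg a `*` setT].
pose edge b (F : set (K * bool)) := forall z, F z -> (X b z.1 <-> z.2).
have St := stationary_setI_limit hK (stationary_setT hK).
have gt_b0 b : limit_ordinal b -> b <= b0 -> False.
  by move=> [[x xb] _]; rewrite leNgt (le_lt_trans (b0P x) xb).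
(* All nodes sit at the bottom level [b0], below every limit ordinal, so the conditions on labels
   hold vacuously. *)
apply: (@layered_contradiction _ _ hK _ V (fun=> b0) edge _ _ (fun _ _ => b0)
  layered St) => [b|b x _ _|b x [_ /gt_b0 bF] _ /bF|c b v [_ limc] _ vc|b F limb finF Fb] //.
- apply: sub_small (small_finite_subsets hK (small_setX hK (small_seg hK a) _)).
    by move=> F [FV _]; exact: FV.
  exact/(finite_small hK)/finite_finset.
- by exists v => // b' x [_ /gt_b0 bF] _ _ /bF.
(* [i c] is a point where the sets coded by [c] and [b] differ; the node recording [X b] at these
   points is adjacent to [b] but to no [c] in [F]. *)
have /choice[i iP] : forall c, exists i, F c -> i < a /\ ~ (X c i <-> X b i).
  move=> c; have [Fc|nFc] := pselect (F c); last by exists b0.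
  apply: contrapT => nex; have cb : c < b := Fb c Fc.
  suff cb' : c = b by rewrite cb' ltxx in cb.
  apply: Xinj => //; apply/seteqP; split=> j Xj; apply: contrapT => nXj; apply: nex;
    exists j => _; split=> [|[XX XX']]; try exact: (Xa _ _ j Xj); first exact: nXj (XX Xj).
  exact: nXj (XX' Xj).
exists [set (i c, `[< X b (i c) >]) | c in F]; split=> /=.
- split; first exact: finite_image.
  by move=> _ [c Fc <-]; split=> //=; have [] := iP c Fc.
- by have [[x xb] _] := limb; exact: le_lt_trans xb.
- by move=> _ [c Fc <-] /=; split=> [/asboolT|/asboolP].
move=> c Fc /(_ (i c, `[< X b (i c) >]) (ex_intro2 _ _ c Fc erefl)) /= [XX XX'].
have [_] := iP c Fc; apply; split=> [/XX/asboolP//|Xb]; apply: XX'; exact/asboolP.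
Qed.

(** * Stationarity of the regular cardinals *)

Lemma limit_infinite (a : K) : limit_ordinal a -> infinite_set (seg a).
Proof.
move=> lima fina; have [b ba /(_ b ba)] := finite_strict_bound (f := id) lima fina (fun x => id).
by rewrite ltxx.
Qed.

(** If [a] injects into some [b < a], take [m = b] and the interval above [b]. Otherwise some
    cofinal [A] is smaller than [a]; its collapse [g] misses some [k < a], and since the values of
    [g] on [A] are closed downwards they all lie below [m = k]. *)
Lemma singular_ladder (a : K) : limit_ordinal a -> ~ regular_cardinal (seg a) ->
  exists (m : K) (C : set K) (f : K -> K), [/\ m < a,
    forall c, C c -> m < c /\ c < a, forall x, x < a -> exists2 c, C c & x < c,
    forall c, C c -> f c < m & forall c c', C c -> C c' -> f c = f c' -> c = c'].
Proof.
move=> lima sing; have [_ lim] := lima; have infa := limit_infinite lima.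
have [[b [ba /not_andP[]]]|init] :=
    pselect (exists b, b < a /\ ~ card_lt (seg b) (seg a)).
- by case; apply: subset_card_le => x; move/lt_trans; apply.
- move=> /contrapT /(card_le_fun (infinite_setN0 infa))[f [fb finj]].
  exists b, [set c | b < c /\ c < a], f; split=> //.
  + by move=> x xa; have [z [za xz bz]] := limit_lt_max lima xa ba; exists z.
  + by move=> c [_ ca]; exact: fb.
  + by move=> c c' [_ ca] [_ ca']; exact: finj.
have [A [Aa cofA] nAa] : exists2 A, cofinal (seg a) A & ~ (A #= seg a).
  apply: contrapT => nex; apply: sing; split=> // [b ba|A cofA].
    by apply: contrapT => nlt; apply: init; exists b.
  by apply: contrapT => nAa; apply: nex; exists A.
have nle : ~ (seg a #<= A).
  by move=> aA; apply: nAa; apply/card_eqPle; split=> //; exact: subset_card_le.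
have [wf _ _] := hK; pose r (y x : K) := A y /\ y < x.
have rwf : well_founded r.
  by move=> x; elim/(well_founded_induction wf): x => x IH; constructor=> y [_ /IH].
have [g gP] := collapse hK rwf.
(* By induction [g y <= y], so [x] itself is a value not taken below [x], as [collapse] requires. *)
have gle x : A x -> g x <= x /\ (forall y, r y x -> g y <> g x) /\
    forall k, k < g x -> exists2 y, r y x & g y = k.
  elim/(well_founded_induction wf): x => x IH Ax.
  have gx y : r y x -> g y <> x.
    move=> [Ay yx] gyx; have [+ _] := IH y yx Ay.
    by rewrite gyx leNgt yx.
  have [|g1 g2] := gP x; first by exists x.
  split=> //; rewrite leNgt; apply/negP => /g2[y ryx gyx]; exact: gx gyx.
have ginj x y : A x -> A y -> g x = g y -> x = y.
  move=> Ax Ay gxy; have [_ [gx _]] := gle x Ax; have [_ [gy _]] := gle y Ay.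
  have [xy|yx|//] := ltgtP x y; first by case: (gy x).
  by case: (gx y).
have [k ka nk] : exists2 k, k < a & forall x, A x -> g x <> k.
  apply: contrapT => nex; apply: nle.
  apply: card_le_trans (card_image_le g A); apply: subset_card_le => k ka.
  apply: contrapT => nk; apply: nex; exists k => // x Ax gxk; apply: nk.
  by exists x.
exists k, (A `&` [set c | k < c]), g; split=> //.
- by move=> c [Ac kc]; split=> //; exact: Aa.
- move=> x xa; have [z [za xz kz]] := limit_lt_max lima xa ka.
  have [y Ay zy] := cofA z za.
  by exists y; [split=> //=; exact: lt_le_trans zy|exact: lt_le_trans zy].
- move=> c [Ac _]; have [_ [_ gc]] := gle c Ac.
  have [//|kc|gck] := ltgtP (g c) k; last by case: (nk c).
  by have [y [Ay _] gyk] := gc k kc; case: (nk y).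
- by move=> c c' [Ac _] [Ac' _]; exact: ginj.
Qed.

Lemma layered_stationary_regular :
  stationary [set: K] [set a : K | regular_cardinal (seg a)].
Proof.
split=> // E clubE; apply: contrapT => nreg.
have [b0 b0P] := bottom_ex hK.
have singE a : E a -> ~ regular_cardinal (seg a).
  by move=> Ea rega; apply: nreg; exists a.
have [h hE] := club_closed_under hK clubE.
have St := stationary_closed_under hK h (stationary_setT hK).
(* [D a] packs the triple [(m_a, C_a, f_a)]; outside [E], [f_a] is the identity. *)
have /choice[D DP] : forall a, exists D : K * set K * (K -> K),
  limit_ordinal a -> [/\ forall c, D.1.2 c -> D.1.1 < c /\ c < a,
    forall x, x < a -> exists2 c, D.1.2 c & x < c,
    forall c, D.1.2 c -> D.2 c <= c,
    E a -> (forall c, D.1.2 c -> D.2 c < D.1.1) /\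
      forall c c', D.1.2 c -> D.1.2 c' -> D.2 c = D.2 c' -> c = c' &
    ~ E a -> forall c, E c -> c < a -> c <= D.1.1].
  move=> a; have [lima|nlima] := pselect (limit_ordinal a); last first.
    by exists (b0, set0, id).
  have [Ea|nEa] := pselect (E a).
    have [m [C [f [ma Cm Ccof fm finj]]]] := singular_ladder lima (singE a Ea).
    exists (m, C, f) => _; split=> //= c Cc; have [mc _] := Cm c Cc.
    by apply: ltW; apply: lt_trans mc; exact: fm.
  have [m ma mE] : exists2 m, m < a & forall c, E c -> c < a -> c <= m.
    apply: contrapT => nex; apply: nEa; have [_] := clubE; apply=> //.
    split=> [c []//|x xa]; apply: contrapT => nx; apply: nex; exists x => // c Ec ca.
    by rewrite leNgt; apply/negP => xc; apply: nx; exists c => //; exact: ltW.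
  exists (m, [set c | m < c /\ c < a], id) => _; split=> //= x xa.
  by have [z [za xz mz]] := limit_lt_max lima xa ma; exists z.
pose V := [set z : K * K | z.2 <= z.1].
pose edge b (z : K * K) := [/\ limit_ordinal b, (D b).1.2 z.1 & z.2 = (D b).2 z.1].
(* The label is the second coordinate when this is regressive, and the default [b0] otherwise. *)
pose lab a (z : K * K) := if z.2 < a then z.2 else b0.
apply: (@layered_contradiction _ _ hK _ V fst edge _ _ lab layered St).
- move=> a; apply: sub_small (small_setX hK (small_seg hK a) (small_seg hK a)).
  by move=> [x y] [/= yx xa]; split=> //=; exact: le_lt_trans xa.
- move=> b z _ [limb Dz _]; have [/(_ _ Dz)[_ /ltW]] := DP b limb.
  by [].
- move=> a z [_ [[[x xa] _] _]] _ _; rewrite /lab; case: ifP => // _.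
  exact: le_lt_trans xa.
- move=> c b v [_ hc] cb vc.
  (* Outside this case no node below [c] is adjacent to [b]: if [b] is not in [E], then [c < b]
     because [c] is in [E], and so [c <= m_b]. Any bound then serves. *)
  have [[limb Eb mc]|nmc] :=
    pselect [/\ limit_ordinal b, E b & (D b).1.1 < c]; last first.
    exists v => // a [x y] _ _ _ /= _ xc _ [limb Dx _].
    have [/(_ _ Dx)[mx _] _ _ _ nE] := DP b limb.
    have [Eb|nEb] := pselect (E b).
      by case: nmc; split=> //; exact: lt_trans xc.
    have {}cb : c < b.
      rewrite lt_neqAle cb andbT; apply/eqP => bc; apply: nEb.
      by rewrite -bc; exact: hE.
    have := nE nEb c (hE _ hc) cb; rewrite leNgt => /negP[].
    exact: lt_trans xc.
  have [_ _ _ /(_ Eb)[fm finj] _] := DP b limb.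
  (* If the label is genuine, injectivity of [f_b] leaves only the node over [x]; if it is the
     default, then [a <= f_b x' < m_b]. *)
  have [[x [Dx xc fx]]|nex] :=
    pselect (exists x, [/\ (D b).1.2 x, x < c & (D b).2 x = v]).
    exists (Order.max (D b).1.1 x); first by rewrite gt_max mc.
    move=> a [x' y] _ _ _ /= ax' _ + [_ /= Dx' yx']; rewrite /lab /= le_max.
    case: ifP => [ya yv|ya _]; last first.
      by rewrite yx' in ya; rewrite (le_trans _ (ltW (fm x' Dx'))) // leNgt ya.
    by rewrite (finj x x') ?ax' ?orbT // fx -yv.
  exists (D b).1.1 => // a [x y] _ _ _ /= ax xc + [_ /= Dx yx]; rewrite /lab /=.
  case: ifP => [ya yv|ya _]; first by case: nex; exists x; split=> //; rewrite -yx.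
  by rewrite yx in ya; rewrite (le_trans _ (ltW (fm x Dx))) // leNgt ya.
(* A top is adjacent only to nodes of level below itself, so a node of [a] above all of [F] avoids
   the tops in [F]. *)
move=> a F lima finF Fa.
have [b ba Fb] := finite_strict_bound (f := id) lima finF Fa.
have [Ca cofa fa _ _] := DP a lima; have [x Dx bx] := cofa b ba.
exists (x, (D a).2 x); split=> //=; first exact: fa.
  by have [] := Ca x Dx.
move=> c Fc [limc /= Dcx _]; have [/(_ _ Dcx)[_ xc] _ _ _ _] := DP c limc.
by have := lt_trans (lt_trans xc (Fb c Fc)) bx; rewrite ltxx.
Qed.

(** * Reflection of stationary sets *)

Lemma layered_reflects (S : set K) : stationary [set: K] S -> reflects S.
Proof.
move=> St; apply: contrapT => nrefl; have [b0 b0P] := bottom_ex hK.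
have /choice[C CP] : forall a, exists C, limit_ordinal a ->
    club (seg a) C /\ forall c, S c -> ~ C c.
  move=> a; have [lima|nlima] := pselect (limit_ordinal a); last by exists set0.
  apply: contrapT => nC; apply: nrefl; exists a; split=> //.
  split=> [x []//|C clubC]; apply: contrapT => ne; apply: nC; exists C => _.
  split=> // c Sc Cc; apply: ne; exists c; split=> //; split=> //.
  by have [[Ca _] _] := clubC; exact: Ca.
(* The label of [(x, A)] at [a] bounds the part of [A] below [a] whenever that part is bounded in
   [a]. *)
have /choice[lab labP] : forall az : K * (K * set K), exists v,
    (limit_ordinal az.1 -> v < az.1) /\
    ((exists2 u, u < az.1 & forall y, az.2.2 y -> y < az.1 -> y <= u) ->
      forall y, az.2.2 y -> y < az.1 -> y <= v).
  move=> [a [x A]] /=.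
  have [[u ua uP]|nex] := pselect (exists2 u, u < a & forall y, A y -> y < a -> y <= u).
    by exists u.
  by exists b0; split=> // -[[y ya] _]; exact: le_lt_trans ya.
pose V := [set z : K * set K | z.2 `<=` seg z.1].
pose edge b (z : K * set K) :=
  [/\ limit_ordinal b, C b z.1 & z.2 = C b `&` seg z.1].
apply: (@layered_contradiction _ _ hK _ V fst edge _ _ (fun a z => lab (a, z))
  layered (stationary_setI_limit hK St)).
- move=> a; apply: (@sub_small _ _ _ _
    (\bigcup_(x in seg a) (pair x @` [set B | B `<=` seg x]))).
    by move=> [x B] [/= Bx xa]; exists x => //; exists B.
  apply: (small_bigcup hK) => [|x _]; first exact: small_seg.
  (* Nodes over [x] are subsets of [x]; they are few because kappa is a strong limit. *)
  by apply: small_image; have [] := layered_strong_limit (a := x) I.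
- move=> b z _ [limb Cz _]; have [[[/(_ _ Cz) + _] _] _] := CP b limb.
  exact: ltW.
- by move=> a z [_ lima] _ _; have [+ _] := labP (a, z); apply.
- move=> c b v [_ limc] cb vc.
  (* As [a] is in [S] and hence not in the closed set [C b], the part of [C b] below [a] is bounded
     in [a]. Since [a <= x], the node determines this part, so its label bounds it. *)
  have Cle a x A : (S `&` [set a | limit_ordinal a]) a -> a <= x ->
      lab (a, (x, A)) = v -> edge b (x, A) ->
      v < a /\ forall y, C b y -> y < a -> y <= v.
    move=> [Sa lima] ax labv [/= limb Cx eA].
    have [[[Cb _] Cclosed] CS] := CP b limb.
    have [/(_ lima) + labu] := labP (a, (x, A)); rewrite labv => va; split=> // y Cy ya.
    rewrite labv /= in labu; apply: labu => //; last first.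
      by rewrite eA; split=> //; exact: lt_le_trans ax.
    apply: contrapT => nex; apply: (CS a Sa); apply: Cclosed => //.
      exact: le_lt_trans ax (Cb x Cx).
    split=> [z []//|z za]; apply: contrapT => nz; apply: nex; exists z => // w.
    rewrite eA => -[Cw _] wa; rewrite leNgt; apply/negP => zw; apply: nz.
    by exists w => //; exact: ltW.
  (* A point [w] of [C b] strictly between [v] and [c] bounds every such [a], since [w < a] would
     force [w <= v]. Without such a [w] no node qualifies, as [x] itself would be one. *)
  have [[w [Cw vw wc]]|nw] := pselect (exists w, [/\ C b w, v < w & w < c]).
    exists w => // a [x A] Ta _ _ /= ax _ labv ebx.
    have [_ /(_ w Cw)] := Cle a x A Ta ax labv ebx.
    move=> wv; rewrite leNgt; apply/negP => wa.
    by have := wv wa; rewrite leNgt vw.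
  exists v => // a [x A] Ta _ _ /= ax xc labv ebx.
  have [va _] := Cle a x A Ta ax labv ebx; case: nw; exists x; split=> //.
    by case: ebx.
  exact: lt_le_trans ax.
move=> a F lima finF Fa.
have [b ba Fb] := finite_strict_bound (f := id) lima finF Fa.
have [_ lim] := lima; have [b' [bb' ba']] := lim b ba.
have [[[Ca cofa] _] _] := CP a lima; have [x Cx bx] := cofa b' ba'.
exists (x, C a `&` seg x); split=> //=; [by move=> y []|exact: Ca|].
move=> c Fc [limc /= Ccx _]; have [[[/(_ _ Ccx) xc _] _] _] := CP c limc.
have := lt_le_trans (lt_trans (lt_trans xc (Fb c Fc)) bb') bx.
by rewrite ltxx.
Qed.

End LayeredCardinals.

Local Open Scope classical_set_scope.
Local Open Scope card_scope.

Theorem theorem1p11 (d : Order.disp_t) (K : orderType d)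
  (hK : uncountable_regular K)
  (hlayered : forall (e : Order.disp_t) (P : porderType e),
     [set: P] #<= [set: K] -> Knaster K P -> stationarily_layered K P) :
  mahlo K /\
  (forall S : set K, stationary [set: K] S -> reflects S).
Proof.
split; last exact: layered_reflects.
have [wf unc reg] := hK; split=> //; last exact: layered_stationary_regular.
by split=> //; exact: layered_strong_limit.
Qed.
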